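(* Let $1\le\lambda<\infty$ and let $K$ be a compact set in an $\mathcal{N}_{\lambda+}$-space $\mathcal{Y}$. Then $d_n(K,\mathcal{Y})\le\lambda\, d_n^a(K)$ for all $n\in\mathbb{N}$.
   Context: For a subset $K$ of a Banach space $\mathcal{X}$ and an integer $n\ge 0$, the Kolmogorov $n$-width is $d_n(K,\mathcal{X})=\inf_{\mathcal{X}_n}\sup_{x\in K}\inf_{z\in\mathcal{X}_n}\|x-z\|$, the outer infimum being over all linear subspaces $\mathcal{X}_n\subset\mathcal{X}$ of dimension at most $n$. For a compact $K$ in a Banach space $\mathcal{Y}$, the $n$-th absolute width is $d_n^a(K)=\inf_{\mathcal{Z}}d_n(K,\mathcal{Z})$, the infimum being over all Banach spaces $\mathcal{Z}$ containing $\mathcal{Y}$ isometrically as a subspace. For a finite-dimensional normed space $F$ and a Banach space $G\supset F$ (isometrically), $\lambda(F,G)$ is the infimum of $\|P\|$ over linear projections $P$ from $G$ onto $F$; the absolute projection constant is $\lambda(F)=\sup_G\lambda(F,G)$ over all such $G$. A Banach space $\mathcal{Y}$ is an $\mathcal{N}_\nu$-space if for every finite-dimensional subspace $E\subset\mathcal{Y}$ there is a finite-dimensional subspace $F$ with $E\subset F\subset\mathcal{Y}$ and $\lambda(F)\le\nu$. It is an $\mathcal{N}_{\lambda+}$-space if it is an $\mathcal{N}_\nu$-space for each $\nu>\lambda$. *)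

(* Defs.v *)
From HB Require Import structures.
From mathcomp Require Import all_boot all_order all_algebra.
From mathcomp Require Import all_classical all_reals all_analysis.
From mathcomp Require Import complex.

Set Implicit Arguments.
Unset Strict Implicit.
Unset Printing Implicit Defensive.

Import Order.TTheory GRing.Theory Num.Theory.
Import numFieldNormedType.Exports.
Local Open Scope classical_set_scope.
Local Open Scope ring_scope.

(* Banach spaces are taken over either of the two usual scalar fields.  The
   library's norm on a normed module is valued in the scalar field itself, so
   it is brought back to R by [to_real] (on R[i] norms have no imaginary part). *)
Variant scalar_kind := RealScalars | ComplexScalars.

Definition scalar_field (R : realType) (s : scalar_kind) : numFieldType :=
  match s with RealScalars => R | ComplexScalars => R[i] end.

Definition to_real (R : realType) (s : scalar_kind) : scalar_field R s -> R :=
  match s return scalar_field R s -> R with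
  | RealScalars => id
  | ComplexScalars => @complex.Re R
  end.

Definition rnorm (R : realType) (s : scalar_kind)
    (V : normedModType (scalar_field R s)) (x : V) : R := to_real `|x|.

(* A linear subspace S of V as a normed module of its own. *)
Section SubspaceType.
Context (K : numFieldType) (V : normedModType K).

Definition linear_subspace (S : submodClosed V) : Type := {x : V | x \in S}.

Context (S : submodClosed V).

HB.instance Definition _ := Choice.on (linear_subspace S).
HB.instance Definition _ := SubChoice.on (linear_subspace S).
HB.instance Definition _ := [SubChoice_isSubLmodule of linear_subspace S by <:].

Definition subspace_norm (x : linear_subspace S) : K := `|\val x|.

Lemma subspace_normD x y :
  subspace_norm (x + y) <= subspace_norm x + subspace_norm y.
Proof. by rewrite /subspace_norm raddfD; exact: ler_normD. Qed.

Lemma subspace_normZ (a : K) x :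
  subspace_norm (a *: x) = `|a| * subspace_norm x.
Proof. by rewrite /subspace_norm linearZ; exact: normrZ. Qed.

Lemma subspace_norm_eq0 x : subspace_norm x = 0 -> x = 0.
Proof. by move=> /normr0_eq0 x0; apply: val_inj; rewrite x0 raddf0. Qed.

HB.instance Definition _ := Lmodule_isNormed.Build K (linear_subspace S)
  subspace_normD subspace_normZ subspace_norm_eq0.

End SubspaceType.

Definition dim_le (K : numFieldType) (V : lmodType K) (n : nat) : Prop :=
  exists2 m : nat, (m <= n)%N & inhabited (Vector.axiom m V).

Definition finite_dim (K : numFieldType) (V : lmodType K) : Prop :=
  exists m : nat, inhabited (Vector.axiom m V).

Section Widths.
Context (R : realType) (s : scalar_kind).
Local Notation K := (scalar_field R s).
Local Open Scope ereal_scope.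

Definition dist (X : normedModType K) (x : X) (S : set X) : \bar R :=
  ereal_inf [set (rnorm (x - z)%R)%:E | z in S].

(* On A = set0 the supremum is -oo rather than 0. *)
Definition width (n : nat) (X : normedModType K) (A : set X) : \bar R :=
  ereal_inf [set w | exists2 S : submodClosed X, dim_le (linear_subspace S) n &
                       w = ereal_sup [set dist x [set` S] | x in A]].

Definition isometric (X Z : normedModType K) (j : X -> Z) : Prop :=
  forall x, rnorm (j x) = rnorm x.

(* A space containing Y isometrically is given by a linear isometry j from Y. *)
Definition absolute_width (n : nat) (Y : completeNormedModType K) (A : set Y) :
    \bar R :=
  ereal_inf [set w | exists (Z : completeNormedModType K) (j : {linear Y -> Z}),
                       isometric j /\ w = width n (j @` A)].

(* +oo for an unbounded map *)
Definition opnorm (X Z : normedModType K) (f : X -> Z) : \bar R :=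
  ereal_sup [set (rnorm (f x))%:E | x in [set x | (rnorm x <= 1)%R]].

Definition projection_onto (G : lmodType K) (P : {linear G -> G}) (F : set G) :
    Prop :=
  (forall x, P (P x) = P x) /\ range P = F.

Definition projection_constant (G : normedModType K) (F : set G) : \bar R :=
  ereal_inf [set opnorm P | P in [set P : {linear G -> G} | projection_onto P F]].

Definition absolute_projection_constant (F : normedModType K) : \bar R :=
  ereal_sup [set c | exists (G : completeNormedModType K) (j : {linear F -> G}),
                       isometric j /\ c = projection_constant (range j)].

Definition N_space (nu : R) (Y : completeNormedModType K) : Prop :=
  forall E : submodClosed Y, finite_dim (linear_subspace E) ->
  exists F : submodClosed Y,
    [/\ finite_dim (linear_subspace F), {subset E <= F} &
        absolute_projection_constant (linear_subspace F) <= nu%:E].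

Definition N_plus_space (lambda : R) (Y : completeNormedModType K) : Prop :=
  forall nu : R, (lambda < nu)%R -> N_space nu Y.

End Widths.

(* Main.v *)
(* Let Z contain Y isometrically and let S be a subspace of Z of dimension at
   most n approximating A within d. The span of a finite net of A lies in a
   finite-dimensional F in Y with projection constant close to lambda, so there
   is a projection P of Z onto F of norm at most c close to lambda. As P fixes
   the net, the subspace P(S) of Y, of dimension at most n, approximates the net
   within about c * d, hence also A, up to the mesh of the net. *)
Require Import Defs.
From mathcomp Require Import all_boot all_order all_algebra.
From mathcomp Require Import all_classical all_reals all_analysis.
From HB Require Import structures.
From mathcomp Require Import finmap complex lra.
Import numFieldNormedType.Exports.

Set Implicit Arguments.
Unset Strict Implicit.
Unset Printing Implicit Defensive.

Import Order.TTheory GRing.Theory Num.Theory.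
Local Open Scope classical_set_scope.
Local Open Scope ring_scope.

(** * Linear spans of finite families *)

Section LinearSpan.
Context (K : fieldType) (V : lmodType K).

Section Span.
Context (m : nat) (w : 'I_m -> V).

Definition combination (u : 'rV[K]_m) : V := \sum_i u 0 i *: w i.

Lemma combination_is_linear : linear combination.
Proof.
move=> a u v; rewrite /combination scaler_sumr -big_split.
by apply: eq_bigr => i _; rewrite !mxE scalerDl scalerA.
Qed.

HB.instance Definition _ :=
  GRing.isLinear.Build K 'rV[K]_m V *:%R combination combination_is_linear.

Definition lspan : {pred V} := fun x => `[< range combination x >].

Lemma lspanP x : reflect (exists u, x = combination u) (x \in lspan).
Proof. by apply: (iffP (asboolP _)) => [[u _ <-]|[u ->]]; exists u. Qed.

Lemma lspan_closed : GRing.subsemimod_closed lspan.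
Proof.
split; first split.
- by apply/lspanP; exists 0; rewrite linear0.
- move=> _ _ /lspanP[u ->] /lspanP[v ->].
  by apply/lspanP; exists (u + v); rewrite linearD.
- move=> a _ /lspanP[u ->]; apply/lspanP; exists (a *: u).
  by rewrite linearZ.
Qed.

HB.instance Definition _ := GRing.isSubmodClosed.Build K V lspan lspan_closed.

Lemma mem_lspan i : w i \in lspan.
Proof.
apply/lspanP; exists (delta_mx 0 i).
rewrite /combination (bigD1 i) //= big1 ?addr0 ?mxE ?eqxx ?scale1r //.
by move=> j ji; rewrite mxE (negPf ji) andbF scale0r.
Qed.

(* A basis of the span is given by a matrix M of coefficients with as many rows
   as possible among those for which u |-> combination (u *m M) is injective. *)
Lemma lspan_basis : exists k (M : 'M[K]_(k, m)),
  [/\ (k <= m)%N, forall u : 'rV[K]_k, combination (u *m M) = 0 -> u = 0 &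
      forall u, exists v, combination u = combination (v *m M)].
Proof.
pose inj k (M : 'M[K]_(k, m)) :=
  forall u : 'rV[K]_k, combination (u *m M) = 0 -> u = 0.
pose P k := `[< exists M : 'M[K]_(k, m), inj k M >].
have exP : exists k, P k.
  by exists 0; apply/asboolP; exists 0 => u _; apply/rowP => -[].
have bndP k : P k -> (k <= m)%N.
  move=> /asboolP[M injM]; have : row_free M.
    by apply: inj_row_free => v vM; apply: injM; rewrite vM linear0.
  by rewrite /row_free => /eqP <-; exact: rank_leq_col.
case: (ex_maxnP exP bndP) => k /[dup] Pk /asboolP[M injM] maxk.
exists k, M; split => //; [exact: bndP|move=> u].
have [PkS|nPkS] := boolP (P k.+1); first by have := maxk _ PkS; rewrite ltnn.
(* Maximality of [k]: adding [u] as a row loses injectivity. In the resulting relation the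
   coefficient [b] of [u] is nonzero, since otherwise injectivity of [M] would give [a = 0]; so the
   relation can be solved for [combination u]. *)
have /existsNP[a /not_implyP[]] : ~ inj _ (col_mx u M).
  by move=> iM; case/asboolP: nPkS; exists (col_mx u M).
rewrite -{1 2}[a](@hsubmxK _ 1 1 k) mul_row_col linearD.
rewrite [lsubmx a]mx11_scalar mul_scalar_mx.
set b : K := lsubmx a 0 0; set c := rsubmx a => abu a0.
have b0 : b != 0.
  apply: contra_notN a0 => /eqP b0; move: abu.
  by rewrite b0 scale0r linear0 add0r => /injM ->; rewrite raddf0 row_mx0.
have cM : combination (c *m M) = - combination (b *: u).
  by apply/eqP; rewrite -addr_eq0 addrC abu.
exists (- b^-1 *: c); rewrite -scalemxAl linearZ /= cM linearZ /=.
by rewrite scalerN scaleNr opprK scalerA mulVf // scale1r.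
Qed.

End Span.

End LinearSpan.

(** * Dimension bounds and generating families *)

Section SubspaceDim.
Context (K : numFieldType) (V : normedModType K).

Definition spanned m (w : 'I_m -> V) : submodClosed V := lspan w.

(** The family may be dependent, while [Vector.axiom] asks for an isomorphism with row vectors. The
    matrix [M] of [lspan_basis] gives one, [h], from row vectors of length [k <= m]. *)
Lemma dim_le_spanned m (w : 'I_m -> V) n :
  (m <= n)%N -> dim_le (linear_subspace (spanned w)) n.
Proof.
move=> mn; have [k [M [km injM spanM]]] := lspan_basis w.
pose h (v : 'rV_k) : linear_subspace (spanned w) :=
  exist _ (combination w (v *m M))
    (introT (lspanP w _) (ex_intro _ (v *m M) erefl)).
have h_surj (x : linear_subspace (spanned w)) : exists v, h v = x.
  case: x => x xl; have /lspanP[u xu] := xl; have [v uv] := spanM u.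
  by exists v; apply: val_inj; rewrite /= -uv.
have h_lin : linear h.
  move=> a u v; apply: val_inj.
  by rewrite linearP /= mulmxDl -scalemxAl linearP.
have h_inj : injective h.
  move=> u v uv; apply/eqP; rewrite -subr_eq0; apply/eqP/injM.
  rewrite mulmxBl linearB /=; apply/eqP; rewrite subr_eq0; apply/eqP.
  exact: (congr1 val uv).
exists k; first exact: leq_trans mn.
pose g x := sval (cid (h_surj x)).
have gK : cancel g h by move=> x; rewrite /g; case: cid.
have hK : cancel h g by move=> v; apply: h_inj; rewrite gK.
constructor; exists g; last by exists h.
move=> a x y; apply: h_inj; rewrite gK.
by rewrite h_lin !gK.
Qed.

(** The generators are the images of the standard basis vectors under the inverse [h] of the
    coordinate map. *)
Lemma dim_le_generators (S : submodClosed V) n :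
  dim_le (linear_subspace S) n ->
  exists2 m, (m <= n)%N & exists z : 'I_m -> V, {subset S <= lspan z}.
Proof.
move=> [m mn [[g g_lin [h gK hK]]]]; exists m => //.
exists (fun i => val (h (delta_mx 0 i))) => x xS.
apply/lspanP; exists (g (exist _ x xS)).
have h_lin : linear h.
  by move=> a u v; apply: (can_inj gK); rewrite g_lin !hK.
pose hL := HB.pack_for {linear 'rV[K]_m -> linear_subspace S} h
  (GRing.isLinear.Build K _ _ *:%R h h_lin).
set u := g _; rewrite /combination.
have -> : x = val (h u) by rewrite gK.
rewrite {1}[u]row_sum_delta -[h _]/(hL _) linear_sum raddf_sum.
by apply: eq_bigr => i _; rewrite linearZ.
Qed.

End SubspaceDim.

(** * The real-valued norm over either scalar field *)

Section RealNorm.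
Context (R : realType) (s : scalar_kind).
Local Notation K := (scalar_field R s).

Definition of_real : R -> K :=
  match s return R -> scalar_field R s with
  | RealScalars => id
  | ComplexScalars => fun r => Complex r 0
  end.

Lemma of_realK : cancel of_real (@to_real R s).
Proof. by rewrite /of_real; case: s. Qed.

Lemma to_realD a b : to_real (a + b :> K) = to_real a + to_real b.
Proof. by move: a b; case: s => //= -[a1 a2] [b1 b2]. Qed.

(** The first factor is real because taking real parts is not multiplicative on [R[i]]. *)
Lemma to_realM (r : R) (a : K) : to_real (of_real r * a) = r * to_real a.
Proof.
rewrite /of_real; move: a.
by case: s => //= -[a1 a2]; rewrite /= mul0r subr0.
Qed.

Lemma to_real_le (a b : K) : a <= b -> to_real a <= to_real b.
Proof. by move: a b; case: s => //= a b; rewrite lecE => /andP[]. Qed.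

(** Comparable elements of [R[i]] have equal imaginary parts, so strictness passes to the real
    parts. *)
Lemma to_real_lt (a b : K) : a < b -> to_real a < to_real b.
Proof. by move: a b; case: s => //= a b; rewrite ltcE => /andP[]. Qed.

Lemma to_real0 : to_real (0 : K) = 0.
Proof. by case: s. Qed.

Lemma of_real_gt0 (r : R) : 0 < r -> 0 < of_real r.
Proof. by rewrite /of_real; case: s => //= r0; rewrite ltcE /= eqxx. Qed.

Section Norm.
Context (V : normedModType K).
Implicit Types x y z : V.

Lemma rnormD x y : rnorm (x + y) <= rnorm x + rnorm y.
Proof. by rewrite /rnorm -to_realD; exact/to_real_le/ler_normD. Qed.

Lemma rnormZ (r : R) x : 0 < r -> rnorm (of_real r *: x) = r * rnorm x.
Proof.
by move=> r0; rewrite /rnorm normrZ gtr0_norm ?to_realM// of_real_gt0.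
Qed.

Lemma rnorm_ge0 x : 0 <= rnorm x.
Proof. by rewrite /rnorm -to_real0; exact/to_real_le/normr_ge0. Qed.

Lemma rnorm0 : rnorm (0 : V) = 0.
Proof. by rewrite /rnorm normr0 to_real0. Qed.

Lemma rnorm_gt0 x : x != 0 -> 0 < rnorm x.
Proof.
by move=> x0; rewrite /rnorm -to_real0; apply/to_real_lt; rewrite normr_gt0.
Qed.

Lemma rnorm_triangle y x z : rnorm (x - z) <= rnorm (x - y) + rnorm (y - z).
Proof. by rewrite -[x - z](subrKA y); exact: rnormD. Qed.

Lemma rnorm_distC x y : rnorm (x - y) = rnorm (y - x).
Proof. by rewrite /rnorm distrC. Qed.

Lemma compact_net (A : set V) (e : R) : compact A -> 0 < e ->
  exists m (c : 'I_m -> V), forall x, A x -> exists i, rnorm (c i - x) < e.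
Proof.
move=> + e0; rewrite compact_cover.
case/(_ V setT (fun c => ball c (of_real e))).
- by move=> c _; apply: ball_open; exact: of_real_gt0.
- by move=> x _; exists x => //; apply: ballxx; exact: of_real_gt0.
move=> D _ AD; exists #|` D|, (fun i => nth 0 (enum_fset D) i) => x /AD[c cD].
rewrite -ball_normE /= => /to_real_lt; rewrite of_realK => xc.
have ci : (index c (enum_fset D) < #|` D|)%N by rewrite index_mem.
by exists (Ordinal ci); rewrite /= nth_index.
Qed.

End Norm.

Lemma rnorm_le_opnorm (X Z : normedModType K) (f : {linear X -> Z}) (c : R) x :
  (opnorm f <= c%:E)%E -> rnorm (f x) <= c * rnorm x.
Proof.
move=> fc; have [->|/rnorm_gt0 x0] := eqVneq x 0.
  by rewrite linear0 !rnorm0 mulr0.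
pose y := of_real (rnorm x)^-1 *: x.
have y1 : rnorm y = 1 by rewrite rnormZ ?invr_gt0// mulVf ?gt_eqF.
have : ((rnorm (f y))%:E <= c%:E)%E.
  by apply: le_trans fc; apply: ereal_sup_ubound; exists y => //=; rewrite y1.
by rewrite lee_fin linearZ rnormZ ?invr_gt0// mulrC ler_pdivrMr.
Qed.

End RealNorm.

(** * Comparison of widths through projections *)

Section Comparison.
Context (R : realType) (s : scalar_kind).
Local Notation K := (scalar_field R s).
Local Open Scope ereal_scope.

(** The span of the [x i] lies in some [F] with absolute projection constant at most [nu], and [j]
    embeds [F] in [Z]. The infimum over projections onto that copy of [F] need not be attained; the
    room between [nu] and [c] yields an actual [P]. *)
Lemma N_space_projection (nu c : R) (Y Z : completeNormedModType K)
    (j : {linear Y -> Z}) m (x : 'I_m -> Y) :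
  isometric j -> N_space nu Y -> (nu < c)%R ->
  exists P : {linear Z -> Z}, [/\ opnorm P <= c%:E,
    forall z, exists y, j y = P z & forall i, P (j (x i)) = j (x i)].
Proof.
move=> iso NY nuc.
have [F [_ EF Fnu]] : exists F : submodClosed Y,
    [/\ finite_dim (linear_subspace F), {subset spanned x <= F} &
        absolute_projection_constant (linear_subspace F) <= nu%:E].
  by apply: NY; have [k _ Vk] := dim_le_spanned x (leqnn m); exists k.
pose jF : {linear linear_subspace F -> Z} := j \o val.
have jF_iso : isometric jF by move=> y; rewrite /jF /= iso.
have : projection_constant (range jF) < c%:E.
  apply: (@le_lt_trans _ _ nu%:E); last by rewrite lte_fin.
  apply: le_trans Fnu; apply: ereal_sup_ubound.
  by exists Z, jF.
move=> /ereal_inf_lt[_ [P [PP rP] <-] /ltW Pc].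
exists P; split=> // [z|i].
  have : range P (P z) by exists z.
  by rewrite rP => -[y _ <-]; exists (val y).
have : range jF (j (x i)).
  by exists (exist _ (x i) (EF _ (mem_lspan x i))).
by rewrite -rP => -[z _ <-]; rewrite PP.
Qed.

Lemma width_le_approx (nu c d e : R) n (Y Z : completeNormedModType K)
    (A : set Y) (j : {linear Y -> Z}) (S : submodClosed Z) :
  isometric j -> N_space nu Y -> compact A ->
  (nu < c)%R -> (0 <= c)%R -> (0 < e)%R -> dim_le (linear_subspace S) n ->
  (forall x, A x -> exists2 z, z \in S & (rnorm (j x - z) <= d)%R) ->
  width n A <= (c * (d + e) + e)%:E.
Proof.
move=> iso NY cA nuc c0 e0 /dim_le_generators[m mn [z zS]] Sd.
have [k [x xA]] := compact_net cA e0.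
have [P [Pc Pj Px]] := N_space_projection x iso NY nuc.
(* The [w i] are preimages in [Y] of the projected generators of [S], so [j] maps their span onto a
   space containing [P(S)]; there are [m <= n] of them. *)
pose w i := sval (cid (Pj (z i))).
have jw i : j (w i) = P (z i) by rewrite /w; case: cid.
apply: (@le_trans _ _ (ereal_sup [set dist y [set` spanned w] | y in A])).
  apply: ereal_inf_lbound; exists (spanned w) => //.
  exact: dim_le_spanned.
apply: ge_ereal_sup => _ [y Ay <-].
have [v vS yv] := Sd _ Ay; have [i xy] := xA _ Ay.
have /lspanP[u vu] := zS _ vS.
apply: ge_ereal_inf; exists (rnorm (y - combination w u))%:E.
  by exists (combination w u) => //=; apply/lspanP; exists u.
have jwu : j (combination w u) = P v.
  rewrite vu /combination !linear_sum; apply: eq_bigr => l _.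
  by rewrite !linearZ jw.
rewrite lee_fin; apply: (le_trans (rnorm_triangle (x i) _ _)).
rewrite addrC; apply: lerD; last by rewrite rnorm_distC ltW.
(* Since [P] fixes [j (x i)], the distance from [x i] to [combination w u] is the norm of
   [P (j (x i) - v)], at most [c] times that of [j (x i) - v], which is bounded through [j y] by
   [d + e]. *)
rewrite -iso linearB jwu -Px -linearB.
apply: (le_trans (rnorm_le_opnorm _ Pc)); apply: ler_wpM2l => //.
apply: (le_trans (rnorm_triangle (j y) _ _)).
by rewrite addrC lerD // -linearB iso ltW.
Qed.

(** Empty sets are treated apart: the supremum over them is [-oo], so the nonnegativity of widths
    used below fails. *)
Lemma width_set0 n (Y : normedModType K) : width n (set0 : set Y) = -oo.
Proof.
apply/eqP; rewrite -leeNy_eq; apply: ereal_inf_lbound.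
pose w (i : 'I_0) : Y := 0%R.
exists (spanned w); last by rewrite image_set0 ereal_sup0.
exact: dim_le_spanned.
Qed.

Lemma width_ge0 n (Y : normedModType K) (A : set Y) :
  A !=set0 -> 0 <= width n A.
Proof.
move=> [x Ax]; apply: le_ereal_inf_tmp => _ [S _ ->].
apply: le_ereal_sup_tmp; exists (dist x [set` S]); first by exists x.
by apply: le_ereal_inf_tmp => _ [z _ <-]; rewrite lee_fin rnorm_ge0.
Qed.

Lemma absolute_width_ge0 n (Y : completeNormedModType K) (A : set Y) :
  A !=set0 -> 0 <= absolute_width n A.
Proof.
move=> A0; apply: le_ereal_inf_tmp => _ [Z [j [_ ->]]].
by apply/width_ge0; case: A0 => x Ax; exists (j x); exists x.
Qed.

Lemma absolute_width_lt n (Y : completeNormedModType K) (A : set Y) (d : R) :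
  absolute_width n A < d%:E ->
  exists (Z : completeNormedModType K) (j : {linear Y -> Z})
    (S : submodClosed Z),
    [/\ isometric j, dim_le (linear_subspace S) n &
      forall x, A x -> exists2 z, z \in S & (rnorm (j x - z) <= d)%R].
Proof.
move=> /ereal_inf_lt[_ [Z [j [iso ->]]]] /ereal_inf_lt[_ [S Sn ->] Sd].
exists Z, j, S; split => // x Ax.
have : dist (j x) [set` S] < d%:E.
  apply: le_lt_trans Sd; apply: ereal_sup_ubound.
  by exists (j x) => //; exists x.
by move=> /ereal_inf_lt[_ [z zS <-]] /ltW; rewrite lee_fin => ?; exists z.
Qed.

End Comparison.

Theorem proposition2p2 (R : realType) (s : scalar_kind) (lambda : R)
    (Y : completeNormedModType (scalar_field R s)) (A : set Y) :
  (1 <= lambda)%R -> N_plus_space lambda Y -> compact A ->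
  forall n : nat, (width n A <= lambda%:E * absolute_width n A)%E.
Proof.
move=> lambda1 NY cA n.
have lambda0 : 0 < lambda by exact: lt_le_trans lambda1.
have [->|/set0P A0] := eqVneq A set0; first by rewrite width_set0 leNye.
move: (absolute_width_ge0 n A0) (@absolute_width_lt _ _ n Y A).
case: (absolute_width n A) => [d| |]; last 2 first.
- by move=> _ _; rewrite mulry gtr0_sg // mul1e leey.
- by rewrite leeNy_eq.
rewrite lee_fin => d0 approx.
apply/lee_addgt0Pr => eta eta0.
(* The final bound is [(lambda + 2 * e) * (d + 2 * e) + e]. Expanding it and using [e^2 <= e] for
   the term [4 * e^2] gives at most [lambda * d + e * M]. *)
pose M : R := 2 * lambda + 2 * d + 5.
pose e := Num.min 1 (eta / M).
have M0 : 0 < M by rewrite /M; lra.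
have e0 : 0 < e by rewrite lt_min ltr01 divr_gt0.
have e1 : e <= 1 by rewrite ge_min lexx.
have eM : e * M <= eta by rewrite -ler_pdivlMr // ge_min lexx orbT.
(* Each infimum costs one [e]: the absolute width is approached within [d + e], the [N_space]
   constant is [lambda + e], and the projection has norm at most [lambda + 2 * e]. The mesh of the
   net is also [e]. *)
have [|Z [j [S [iso Sn Sd]]]] := approx (d + e).
  by rewrite lte_fin; lra.
apply: le_trans (@width_le_approx _ _ (lambda + e) (lambda + 2 * e) _ e
  _ _ _ _ _ _ iso _ cA _ _ e0 Sn Sd) _.
- by apply: NY; lra.
- by lra.
- by lra.
rewrite -EFinM -EFinD lee_fin; apply: le_trans (lerD (lexx _) eM).
by rewrite /M; nra.
Qed.
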